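(* Let $\mathscr{A}$ be a unital $C^*$-algebra with unit $e$, let $\nu\in(0,1)$, and let $a,b\in\mathscr{A}$ be positive definite. Then $$C_{\nu}(a,b)=\max_{x+y=e}\left\{(1-\nu)^{-1}\left(\nu a-x^*ax\right)+\nu^{-1}\left((1-\nu)b-y^*by\right)\right\},$$ where the maximum is over all $x,y\in\mathscr{A}$ with $x+y=e$.
   Context: An element of a $C^*$-algebra $\mathscr{A}$ is positive ($0\le a$) if $a=b^*b$ for some $b\in\mathscr{A}$; for self-adjoint $a,b$, $b\le a$ means $0\le a-b$. An element is positive definite if it is positive and invertible. The $\nu$-weighted contraharmonic mean of positive definite $a,b$ is $$C_{\nu}(a,b)=(1-\nu)\nu^{-1}b+\nu(1-\nu)^{-1}a-\left((1-\nu)a^{-1}+\nu b^{-1}\right)^{-1}.$$ The maximum of a set of self-adjoint elements means its greatest element with respect to the order $\le$ (an element of the set that is an upper bound of the set). *)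

(* Defs.v *)
From HB Require Import structures.
From mathcomp Require Import all_boot all_order all_algebra.
From mathcomp Require Import all_classical all_reals.
From mathcomp.real_closed Require Import complex.
Set Implicit Arguments.
Unset Strict Implicit.
Unset Printing Implicit Defensive.
Import Order.TTheory GRing.Theory Num.Theory.
Local Open Scope classical_set_scope.
Local Open Scope ring_scope.
Local Open Scope complex_scope.

(* The norm is a field of the structure, with values in [R], rather than
   inherited from [normedModType R[i]]: Hierarchy-Builder admits no structure
   below both [normedModType] and [unitAlgType], because [numDomainType]
   already joins normed Z-modules with rings.
   As for every MathComp algebra, [1 != 0] in a unital C*-algebra. *)
HB.mixin Record isCStarAlgebra (R : realType) A of GRing.UnitAlgebra R[i] A := {
  cnorm : A -> R ;
  star : A -> A ;
  cnormD_le : forall x y : A, cnorm (x + y) <= cnorm x + cnorm y ;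
  cnormZ : forall (c : R[i]) (x : A), cnorm (c *: x) = ComplexField.Normc.normc c * cnorm x ;
  cnorm_eq0 : forall x : A, cnorm x = 0 -> x = 0 ;
  cnormM_le : forall x y : A, cnorm (x * y) <= cnorm x * cnorm y ;
  cnorm_complete : forall u : nat -> A,
    (forall e : R, 0 < e -> exists N : nat, forall m n : nat,
       (N <= m)%N -> (N <= n)%N -> cnorm (u m - u n) < e) ->
    exists l : A, forall e : R, 0 < e -> exists N : nat, forall n : nat,
       (N <= n)%N -> cnorm (u n - l) < e ;
  starK : involutive star ;
  starD : {morph star : x y / x + y} ;
  starZ : forall (c : R[i]) (x : A), star (c *: x) = conjc c *: star x ;
  starM : forall x y : A, star (x * y) = star y * star x ;
  cnorm_starM : forall x : A, cnorm (star x * x) = cnorm x ^+ 2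
}.

#[short(type="cstarAlgType")]
HB.structure Definition CStarAlgebra (R : realType) :=
  {A of GRing.UnitAlgebra R[i] A & isCStarAlgebra R A}.

Section CStarOrder.
Context {R : realType} {A : cstarAlgType R}.
Implicit Types (nu : R) (a b : A) (S : set A).

Definition selfadjoint a : Prop := star a = a.

Definition cstar_positive a : Prop := exists b, a = star b * b.

Definition cstar_posdef a : Prop := cstar_positive a /\ a \is a GRing.unit.

Definition cstar_le b a : Prop :=
  [/\ selfadjoint b, selfadjoint a & cstar_positive (a - b)].

Definition cstar_greatest S a : Prop := S a /\ forall b, S b -> cstar_le b a.

Definition contraharmonic nu a b : A :=
  ((1 - nu) * nu^-1)%:C *: b + (nu * (1 - nu)^-1)%:C *: a
  - ((1 - nu)%:C *: a^-1 + nu%:C *: b^-1)^-1.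

End CStarOrder.

(* Main.v *)
Require Import Defs.
From HB Require Import structures.
From mathcomp Require Import all_boot all_order all_algebra.
From mathcomp Require Import all_classical all_reals.
From mathcomp.real_closed Require Import complex.
From mathcomp Require Import ring lra.
Set Implicit Arguments.
Unset Strict Implicit.
Unset Printing Implicit Defensive.
Import Order.TTheory GRing.Theory Num.Theory.
Local Open Scope classical_set_scope.
Local Open Scope ring_scope.
Local Open Scope complex_scope.

(* Put [g = a / (1 - nu)], [h = b / nu] and [p = (g^-1 + h^-1)^-1]. Up to a term
   independent of [x] and [y], the expression to maximise is
   [- (star x * g * x + star y * h * y)]. For [x + y = 1] and [d = x - g^-1 * p],
   completing the square gives
     [star x * g * x + star y * h * y = p + star d * (g + h) * d],
   so the maximum is attained at [x = g^-1 * p], [y = h^-1 * p], provided that the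
   last term is positive and that sums of positive definite elements are
   invertible.

   With positivity defined by [a = star t * t], the additivity of positive
   elements is the Kelley-Vaught theorem. It is obtained here without spectra, from
   the additive condition "[h] is self-adjoint and [|M - h| <= M] for some [M]",
   which is shown to be equivalent to positivity. Such an [h] has a square root,
   lying in its bicommutant. Conversely, the square of a self-adjoint element [k]
   satisfies the condition, because [k + i sqrt (M - k^2)] is a multiple of a
   unitary. Finally, for [h = star t * t] one takes [n = |h| - h] and
   [z = t * n]: then [- star z * z = |h| * n^2] satisfies the condition, which
   forces [z = 0] and then [n = 0]. *)

(** * Norm and involution *)

Section Norm.
Context {R : realType} {A : cstarAlgType R}.
Implicit Types (x y z : A) (r : R).

Lemma cnormZr r x : cnorm (r%:C *: x) = `|r| * cnorm x.
Proof. by rewrite cnormZ /= expr0n addr0 sqrtr_sqr. Qed.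

Lemma cnorm0 : cnorm (0 : A) = 0.
Proof. by rewrite -(scale0r (0 : A)) cnormZ Normc.normc0 mul0r. Qed.

Lemma cnormN x : cnorm (- x) = cnorm x.
Proof.
have -> : - x = ((-1)%:C *: x) by rewrite rmorphN rmorph1 scaleN1r.
by rewrite cnormZr normrN1 mul1r.
Qed.

Lemma cnorm_ge0 x : 0 <= cnorm x.
Proof. by have := cnormD_le x (- x); rewrite subrr cnorm0 cnormN; lra. Qed.

Lemma cnormB x y : cnorm (x - y) = cnorm (y - x).
Proof. by rewrite -cnormN opprB. Qed.

Lemma cnormB_le x y : cnorm (x - y) <= cnorm x + cnorm y.
Proof. by rewrite -(cnormN y) cnormD_le. Qed.

Lemma star0 : star (0 : A) = 0.
Proof. by apply: (addrI (star 0)); rewrite -starD !addr0. Qed.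

Lemma star1 : star (1 : A) = 1.
Proof. by rewrite -[star 1]mulr1 -[X in _ * X](starK 1) -starM mulr1 starK. Qed.

Lemma starN x : star (- x) = - star x.
Proof. by apply: (addrI (star x)); rewrite -starD !subrr star0. Qed.

Lemma starB x y : star (x - y) = star x - star y.
Proof. by rewrite starD starN. Qed.

Lemma starZr r x : star (r%:C *: x) = r%:C *: star x.
Proof. by rewrite starZ conjc_real. Qed.

Lemma star_alg r : star (r%:C%:A : A) = r%:C%:A.
Proof. by rewrite starZr star1. Qed.

Lemma starX x n : star (x ^+ n) = star x ^+ n.
Proof. by elim: n => [|n IH]; rewrite ?expr0 ?star1 // exprSr exprS starM IH. Qed.

Lemma starV x : x \is a GRing.unit -> star x^-1 = (star x)^-1.
Proof.
move=> ux; have e1 : star x * star x^-1 = 1 by rewrite -starM mulVr ?star1.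
have e2 : star x^-1 * star x = 1 by rewrite -starM mulrV ?star1.
have us : star x \is a GRing.unit by apply/unitrP; exists (star x^-1).
by apply: (mulrI us); rewrite e1 mulrV.
Qed.

Lemma cnorm1 : cnorm (1 : A) = 1.
Proof.
have := cnorm_starM (1 : A); rewrite star1 mulr1 => h.
have h0 : cnorm (1 : A) != 0.
  by apply/eqP => /cnorm_eq0 /eqP; rewrite oner_eq0.
by apply: (mulfI h0); rewrite mulr1 -expr2.
Qed.

Lemma cnorm_alg r : cnorm (r%:C%:A : A) = `|r|.
Proof. by rewrite cnormZr cnorm1 mulr1. Qed.

(** The C*-identity gives [cnorm x ^+ 2 <= cnorm (star x) * cnorm x], where a factor cancels; the
    reverse bound is the same one for [star x]. *)
Lemma cnorm_star x : cnorm (star x) = cnorm x.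
Proof.
wlog suff: x / cnorm x <= cnorm (star x).
  by move=> h; apply/eqP; rewrite eq_le h andbT; have := h (star x); rewrite starK.
have [->|] := eqVneq (cnorm x) 0; first exact: cnorm_ge0.
move=> nx; have xp : 0 < cnorm x by rewrite lt_def nx cnorm_ge0.
by rewrite -(ler_pM2r xp) -expr2 -cnorm_starM cnormM_le.
Qed.

Lemma cnorm_sqr x : star x = x -> cnorm (x ^+ 2) = cnorm x ^+ 2.
Proof. by move=> sx; rewrite -cnorm_starM sx expr2. Qed.

Lemma sa_sqr_eq0 x : star x = x -> x ^+ 2 = 0 -> x = 0.
Proof.
move=> sx x2; apply: cnorm_eq0; apply/eqP.
by have /eqP := cnorm_sqr sx; rewrite x2 cnorm0 eq_sym expf_eq0.
Qed.

End Norm.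

(* The iterates of [F] from [0] are Cauchy because their increments are bounded by
   those of the iterates of the scalar map [G], which increase and stay below [B].
   A condition [T x = 0] propagates to the limit when it holds along the orbit. *)
Section FixedPoint.
Context {R : realType} {A : cstarAlgType R}.
Context (F : A -> A) (G : R -> R) (B C : R).
Context (B_ge0 : 0 <= B) (C_ge0 : 0 <= C) (F0 : cnorm (F 0) <= G 0).
Context (FG : forall x y r t, cnorm x <= r -> cnorm y <= t ->
  cnorm (x - y) <= r - t -> cnorm (F x - F y) <= G r - G t).
Context (G_le : forall r, 0 <= r <= B -> G r <= B).
Context (F_lip : forall x y, cnorm x <= B -> cnorm y <= B ->
  cnorm (F x - F y) <= C * cnorm (x - y)).

Let u n := iter n F 0.
Let r n := iter n G 0.

(** The two bounds are proved together: [FG] needs the norm bounds to carry the increment bound one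
    step further. *)
Let major n : cnorm (u n) <= r n /\ cnorm (u n.+1 - u n) <= r n.+1 - r n.
Proof.
elim: n => [|n [un dn]].
  by rewrite /u /r /= cnorm0 !subr0.
have un1 : cnorm (u n.+1) <= r n.+1.
  by rewrite -(subrK (u n) (u n.+1)); have := cnormD_le (u n.+1 - u n) (u n); lra.
by split; last exact: FG.
Qed.

Let r_bound n : 0 <= r n <= B.
Proof.
have rn0 k : 0 <= r k by apply: le_trans (major k).1; apply: cnorm_ge0.
by rewrite rn0; elim: n => [|n IH] //=; apply: G_le; rewrite rn0.
Qed.

Let u_diff m n : (m <= n)%N -> cnorm (u n - u m) <= r n - r m.
Proof.
move=> /subnK <-; elim: (n - m)%N => [|k IH]; first by rewrite !subrr cnorm0.
rewrite addSn; have -> : u (k + m).+1 - u m = (u (k + m).+1 - u (k + m)) + (u (k + m) - u m).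
  by rewrite addrA subrK.
by have := cnormD_le (u (k + m).+1 - u (k + m)) (u (k + m) - u m);
  have := (major (k + m)).2; lra.
Qed.

Lemma majorized_fixpoint : exists l : A, [/\ cnorm l <= B, F l = l &
  forall (T : A -> A) K, (forall x y, cnorm (T x - T y) <= K * cnorm (x - y)) ->
    T 0 = 0 -> (forall x, T x = 0 -> T (F x) = 0) -> T l = 0].
Proof.
have u_le n : cnorm (u n) <= B.
  by apply: le_trans (major n).1 _; case/andP: (r_bound n).
have r_nd m n : (m <= n)%N -> r m <= r n.
  by move=> /u_diff; have := cnorm_ge0 (u n - u m); lra.
have [l ul] : exists l, forall e : R, 0 < e -> exists N : nat, forall n : nat,
    (N <= n)%N -> cnorm (u n - l) < e.
  apply: cnorm_complete => e e0.
  have ubr : has_ubound (range r).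
    by exists B => _ [n _ <-]; case/andP: (r_bound n).
  (* As [r] is nondecreasing, once [r N] is within [e] of the supremum all later differences of [r],
     hence of [u], are below [e]. *)
  have [_ [N _ <-] rN] : exists2 t, range r t & sup (range r) - e < t.
    by apply: sup_adherent => //; split=> //; exists (r 0%N), 0%N.
  have r_sup n : r n <= sup (range r) by apply: ub_le_sup => //; exists n.
  exists N => m n Nm Nn.
  have h i j : (i <= j)%N -> (N <= i)%N -> cnorm (u j - u i) < e.
    move=> ij Ni; have := u_diff ij; have := r_sup j; have := r_nd _ _ Ni; lra.
  by case/orP: (leq_total m n) => mn; [rewrite cnormB|]; apply: h.
(* Both [F l = l] and [T l = 0] reduce to this criterion, since the right-hand side tends to 0. *)
have small (z : A) (K : R) : 0 <= K ->
    (forall n, cnorm z <= K * cnorm (u n - l) + cnorm (u n.+1 - l)) -> z = 0.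
  move=> K0 zn; apply: cnorm_eq0; apply/eqP; rewrite eq_le cnorm_ge0 andbT.
  apply/ler_addgt0Pr => e e0; rewrite add0r.
  have eK : 0 < e / (K + 1) by apply: divr_gt0 => //; lra.
  have [N uN] := ul _ eK; apply: le_trans (zn N) _.
  have -> : e = K * (e / (K + 1)) + e / (K + 1) by field; lra.
  by apply: lerD; [apply: ler_wpM2l => //|]; apply/ltW/uN.
have l_le : cnorm l <= B.
  apply/ler_addgt0Pr => e /ul [N /(_ N (leqnn _))]; rewrite cnormB => uN.
  have := cnormD_le (l - u N) (u N); rewrite subrK; have := u_le N; lra.
exists l; split=> // [|T K TK T0 TF].
  apply/eqP; rewrite -subr_eq0; apply/eqP; apply: (small _ C) => // n.
  have -> : F l - l = (F l - F (u n)) + (u n.+1 - l) by rewrite addrA subrK.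
  apply: le_trans (cnormD_le _ _) _; rewrite lerD2r cnormB.
  exact: F_lip.
have Tu n : T (u n) = 0 by elim: n => [|n IH] //=; apply: TF.
apply: (small _ `|K|) => // n.
apply: le_trans (_ : `|K| * cnorm (u n - l) <= _); last by rewrite lerDl cnorm_ge0.
rewrite cnormB -[T l]subr0 -(Tu n); apply: le_trans (TK _ _) _.
by apply: ler_wpM2r; rewrite ?cnorm_ge0 ?ler_norm.
Qed.

End FixedPoint.

(** * Invertibility and square root of [1 - s] *)

Section Sqrt.
Context {R : realType} {A : cstarAlgType R}.
Implicit Types (c s w x y : A) (r : R).

Lemma commutator_lip c x y :
  cnorm (c * x - x * c - (c * y - y * c)) <= (cnorm c + cnorm c) * cnorm (x - y).
Proof.
have -> : c * x - x * c - (c * y - y * c) = c * (x - y) - (x - y) * c.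
  by rewrite mulrBr mulrBl !opprB addrACA [RHS]addrACA; congr (_ + _); exact: addrC.
apply: le_trans (cnormB_le _ _) _; rewrite [leRHS]mulrDl lerD ?cnormM_le //.
by rewrite [leRHS]mulrC cnormM_le.
Qed.

(** The fixed point of [x |-> 1 + s * x] is the sum of the Neumann series, majorized by a scalar
    geometric series. *)
Lemma unit_one_sub s : cnorm s < 1 -> 1 - s \is a GRing.unit.
Proof.
move=> s1; have s0 := cnorm_ge0 s.
have s1' : 0 < 1 - cnorm s by lra.
have mull x y : cnorm (s * x - s * y) <= cnorm s * cnorm (x - y).
  by rewrite -mulrBr cnormM_le.
have [||||||l [_ Fl lT]] := @majorized_fixpoint R A (fun x => 1 + s * x)
  (fun r => 1 + cnorm s * r) (1 - cnorm s)^-1 (cnorm s).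
- by rewrite invr_ge0 ltW.
- exact: s0.
- by rewrite !mulr0 !addr0 cnorm1.
- move=> x y r t _ _ xy; rewrite [in leRHS]opprD [leRHS]addrACA subrr add0r.
  rewrite opprD addrACA subrr add0r.
  by rewrite -[leRHS]mulrBr; apply: le_trans (mull _ _) _; apply: ler_wpM2l.
- move=> r /andP[r0 rB]; set B := (1 - cnorm s)^-1 in rB *.
  have BE : (1 - cnorm s) * B = 1 by rewrite mulfV ?gt_eqF.
  by have := ler_wpM2l s0 rB; lra.
- by move=> x y _ _; rewrite opprD addrACA subrr add0r mull.
(* The fixed-point equation alone makes [l] a right inverse; commutation with [s], inherited from
   the orbit, makes it two-sided. *)
have slC : s * l = l * s.
  apply/eqP; rewrite -subr_eq0; apply/eqP.
  apply: (lT (fun x => s * x - x * s) _ (commutator_lip s)) => [|x /eqP].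
    by rewrite mul0r mulr0 subrr.
  rewrite subr_eq0 => /eqP sx; apply/eqP; rewrite subr_eq0; apply/eqP.
  by rewrite mulrDr mulrDl mulr1 mul1r {1}sx mulrA.
apply/unitrP; exists l; rewrite mulrBr mulrBl mul1r mulr1 -slC.
by split; rewrite -{1}Fl addrK.
Qed.

(* [w] is the fixed point of [x |-> (s + x^2) / 2]. *)
Lemma sqrt_one_sub s : star s = s -> cnorm s <= 1 ->
  exists w, [/\ star w = w, cnorm w <= 1, (1 - w) ^+ 2 = 1 - s &
    forall c, GRing.comm c s -> GRing.comm c w].
Proof.
move=> ss s1; have s0 := cnorm_ge0 s.
have half0 : (0 : R) <= 2^-1 by rewrite invr_ge0.
have sqB x y : cnorm (x ^+ 2 - y ^+ 2) <= (cnorm x + cnorm y) * cnorm (x - y).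
  have -> : x ^+ 2 - y ^+ 2 = x * (x - y) + (x - y) * y.
    by rewrite !expr2 mulrBr mulrBl addrA subrK.
  apply: le_trans (cnormD_le _ _) _; rewrite [leRHS]mulrDl.
  by rewrite lerD ?cnormM_le // [leRHS]mulrC cnormM_le.
pose F x := 2^-1%:C *: (s + x ^+ 2).
have FB x y : cnorm (F x - F y) <= 2^-1 * ((cnorm x + cnorm y) * cnorm (x - y)).
  rewrite -scalerBr cnormZr ger0_norm // ler_wpM2l //.
  by rewrite opprD addrACA subrr add0r.
(* The majorant is the scalar iteration for [s = 1]; it maps [0, 1] into itself. *)
have [||||||w [w1 Fw wT]] :=
  @majorized_fixpoint R A F (fun r => 2^-1 * (1 + r ^+ 2)) 1 1.
- exact: ler01.
- exact: ler01.
- by rewrite /F !expr0n /= !addr0 cnormZr ger0_norm // ler_wpM2l.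
- move=> x y r t xr yt xyr; apply: le_trans (FB _ _) _.
  rewrite -[leRHS]mulrBr ler_wpM2l // opprD addrACA subrr add0r subr_sqr [leRHS]mulrC.
  by apply: ler_pM; rewrite ?addr_ge0 ?cnorm_ge0 // lerD.
- move=> r /andP[r0 r1]; have : r ^+ 2 <= 1 by rewrite expr_le1.
  lra.
- move=> x y x1 y1; apply: le_trans (FB _ _) _.
  have : (cnorm x + cnorm y) * cnorm (x - y) <= 2 * cnorm (x - y).
    by apply: ler_wpM2r; rewrite ?cnorm_ge0 //; lra.
  by lra.
exists w; split=> //.
- apply/eqP; rewrite -subr_eq0; apply/eqP.
  apply: (wT (fun x => star x - x) (1 + 1)) => [x y||x /eqP].
  + have -> : star x - x - (star y - y) = star (x - y) - (x - y).
      by rewrite starB !opprB addrACA [RHS]addrACA; congr (_ + _); exact: addrC.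
    apply: le_trans (cnormB_le _ _) _; rewrite cnorm_star; lra.
  + by rewrite star0 subr0.
  + by rewrite subr_eq0 => /eqP sx; rewrite /F starZr starD starX ss sx subrr.
- rewrite -sqrrN opprB sqrrB1.
  have -> : w *+ 2 = s + w ^+ 2.
    rewrite -{1}Fw /F -scaler_nat scalerA -[2%:R](rmorph_nat (real_complex R) 2).
    by rewrite -rmorphM mulfV ?scale1r // pnatr_eq0.
  by rewrite opprD (addrC (- s)) addrA subrr add0r addrC.
- move=> c cs; apply/eqP; rewrite -subr_eq0; apply/eqP.
  apply: (wT (fun x => c * x - x * c) _ (commutator_lip c)) => [|x /eqP].
  + by rewrite mul0r mulr0 subrr.
  + rewrite subr_eq0 => /eqP cx; apply/eqP; rewrite subr_eq0; apply/eqP.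
    rewrite /F -scalerAr -scalerAl; congr (_ *: _).
    by apply: commrD => //; apply: commrX.
Qed.

End Sqrt.

(** * Norm-positive elements *)

Section NormPositive.
Context {R : realType} {A : cstarAlgType R}.
Implicit Types (a c g h k m q t x y z : A) (e r M : R).

(** The inequality says that the spectrum of the self-adjoint [h] lies in [0, 2M]. Leaving [M]
    existential makes the condition additive. *)
Definition npos h : Prop := star h = h /\ exists M, cnorm (M%:C%:A - h) <= M.

Lemma rscaleK r x : r != 0 -> r%:C *: (r^-1%:C *: x) = x.
Proof. by move=> r0; rewrite scalerA -rmorphM mulfV // rmorph1 scale1r. Qed.

Lemma comm_rscale r x y : GRing.comm x y -> GRing.comm x (r%:C *: y).
Proof. by rewrite /GRing.comm -scalerAr -scalerAl => ->. Qed.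

Lemma npos_sub M h : star h = h -> cnorm h <= M -> npos (M%:C%:A - h).
Proof.
move=> sh hM; split; first by rewrite starB star_alg sh.
by exists M; rewrite opprB addrC subrK.
Qed.

Lemma nposD g h : npos g -> npos h -> npos (g + h).
Proof.
move=> [sg [M gM]] [sh [N hN]]; split; first by rewrite starD sg sh.
exists (M + N); rewrite rmorphD scalerDl opprD addrACA.
by apply: le_trans (cnormD_le _ _) _; apply: lerD.
Qed.

Lemma nposZ r h : 0 <= r -> npos h -> npos (r%:C *: h).
Proof.
move=> r0 [sh [M hM]]; split; first by rewrite starZr sh.
exists (r * M); rewrite rmorphM -scalerA -scalerBr cnormZr ger0_norm //.
exact: ler_wpM2l.
Qed.

Lemma npos_alg r : 0 <= r -> npos (r%:C%:A : A).
Proof.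
by move=> r0; split; [exact: star_alg | exists r; rewrite subrr cnorm0].
Qed.

Lemma npos_sqrt h : npos h -> exists k, [/\ npos k, k ^+ 2 = h &
  forall c, GRing.comm c h -> GRing.comm c k].
Proof.
(* [M0] may be 0; the shift allows writing [h] as [M] times [1 - s], where [s = 1 - h / M] has norm
   at most 1. *)
move=> [sh [M0 hM0]]; pose M := M0 + 1.
have Mp : 0 < M by have := cnorm_ge0 (M0%:C%:A - h); rewrite /M; lra.
have M_neq0 : M != 0 by rewrite gt_eqF.
have hM : cnorm (M%:C%:A - h) <= M.
  rewrite /M rmorphD scalerDl addrAC; apply: le_trans (cnormD_le _ _) _.
  by rewrite cnorm_alg normr1 lerD2r.
have [||w [sw w1 wE wC]] := @sqrt_one_sub _ _ (1 - M^-1%:C *: h).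
- by rewrite starB star1 starZr sh.
- have -> : 1 - M^-1%:C *: h = M^-1%:C *: (M%:C%:A - h).
    by rewrite scalerBr scalerA -rmorphM mulVf // rmorph1 scale1r.
  by rewrite cnormZr gtr0_norm ?invr_gt0 // mulrC ler_pdivrMr // mul1r.
exists ((Num.sqrt M)%:C *: (1 - w)); split.
- split; first by rewrite starZr starB star1 sw.
  exists (Num.sqrt M); rewrite -scalerBr opprB addrC subrK cnormZr.
  by rewrite ger0_norm ?sqrtr_ge0 // -[leRHS]mulr1 ler_wpM2l ?sqrtr_ge0.
- rewrite exprZn -rmorphXn sqr_sqrtr ?ltW // wE opprB addrC subrK.
  exact: rscaleK.
- move=> c ch; apply/comm_rscale/commrB; first exact: commr1.
  by apply: wC; apply: commrB; [exact: commr1 | exact: comm_rscale].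
Qed.

(* [k + i m] is a multiple of a unitary, and [k] is its real part. *)
Lemma cnorm_sum_sqr k m r : star k = k -> star m = m -> GRing.comm k m ->
  k ^+ 2 + m ^+ 2 = r%:C%:A -> cnorm k ^+ 2 <= `|r|.
Proof.
move=> sk sm km kmr; pose u := k + 'i%C *: m.
have su : star u = k - 'i%C *: m.
  by rewrite /u starD starZ sk sm -scaleNr; congr (_ + _ *: _); apply/eqP; rewrite eq_complex /= oppr0 !eqxx.
have uu : star u * u = r%:C%:A.
  rewrite su -kmr mulrDr !mulrBl -!scalerAr -!scalerAl -km scalerA -[_ * 'i%C]expr2 sqr_i.
  by rewrite scaleN1r opprK addrA subrK -!expr2.
have u2 : cnorm u ^+ 2 = `|r| by rewrite -cnorm_starM uu cnorm_alg.
rewrite -u2 ler_sqr ?nnegrE ?cnorm_ge0 //.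
have uk : u + star u = k + k by rewrite su addrACA subrr addr0.
have : cnorm (k + k) <= cnorm u + cnorm u.
  by rewrite -uk -{2}(cnorm_star u) cnormD_le.
have -> : k + k = 2%:C *: k by rewrite rmorph_nat scaler_nat mulr2n.
by rewrite cnormZr ger0_norm //; lra.
Qed.

(** With [m] a square root of [M - k^2], the squares of [m] and [k] sum to [M], so [cnorm_sum_sqr]
    bounds [m]. *)
Lemma cnorm_sub_sqr k M : star k = k -> cnorm k ^+ 2 <= M ->
  cnorm (M%:C%:A - k ^+ 2) <= M.
Proof.
move=> sk kM; have M0 : 0 <= M by apply: le_trans kM; rewrite sqr_ge0.
have [|m [[sm _] m2 mC]] := @npos_sqrt (M%:C%:A - k ^+ 2).
  by apply: npos_sub; rewrite ?starX ?sk ?cnorm_sqr.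
rewrite -m2 cnorm_sqr //; rewrite -[leRHS]ger0_norm //.
apply: (@cnorm_sum_sqr m k) => //; last by rewrite m2 subrK.
apply: commr_sym; apply: mC; apply: commrB; last exact: commrX.
exact/commr_sym/comm_alg.
Qed.

Lemma npos_sqr k : star k = k -> npos (k ^+ 2).
Proof.
move=> sk; split; first by rewrite starX sk.
by exists (cnorm k ^+ 2); apply: cnorm_sub_sqr.
Qed.

(** This frees the choice of [M] in [npos]: every bound of the norm serves, which allows passing to
    limits. *)
Lemma cnorm_npos_sub h M : npos h -> cnorm h <= M -> cnorm (M%:C%:A - h) <= M.
Proof.
move=> /npos_sqrt [k [[sk _] <- _]]; rewrite cnorm_sqr //.
exact: cnorm_sub_sqr.
Qed.

(** By the bicommutant property the square roots commute, so their product is self-adjoint with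
    square [g * h]. *)
Lemma npos_mul_comm g h : npos g -> npos h -> GRing.comm g h -> npos (g * h).
Proof.
move=> /npos_sqrt [k [[sk _] <- kC]] /npos_sqrt [m [[sm _] <- mC]] gh.
have km : GRing.comm k m by apply/mC/commr_sym/kC/commr_sym.
by rewrite -exprMn_comm //; apply: npos_sqr; rewrite starM sk sm.
Qed.

Lemma npos_unit e h : 0 < e -> npos h -> e%:C%:A + h \is a GRing.unit.
Proof.
move=> e0 [sh [M hM]]; have M0 : 0 <= M := le_trans (cnorm_ge0 _) hM.
have Me : 0 < M + e by lra.
have Me0 : M + e != 0 by rewrite gt_eqF.
have -> : e%:C%:A + h = (M + e)%:C *: (1 - (M + e)^-1%:C *: (M%:C%:A - h)).
  by rewrite scalerBr rscaleK // rmorphD scalerDl opprB [RHS]addrC addrA subrK addrC.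
rewrite scaler_unit ?unit_one_sub //; last first.
  by rewrite unitfE fmorph_eq0.
rewrite cnormZr gtr0_norm ?invr_gt0 // mulrC ltr_pdivrMr // mul1r.
by apply: le_lt_trans hM _; lra.
Qed.

Lemma npos_closed h : star h = h ->
  (forall e, 0 < e -> npos (e%:C%:A + h)) -> npos h.
Proof.
move=> sh he; split=> //; exists (cnorm h + 1); apply/ler_addgt0Pr => e e0.
(* For [e <= 1] the single constant [cnorm h + 1] bounds the norm of [e + h]. *)
wlog e1 : e e0 / e <= 1.
  move=> H; have [/H|/ltW e1] := leP e 1; first exact.
  by apply: le_trans (H 1 ltr01 (lexx _)) _; lra.
have -> : (cnorm h + 1)%:C%:A - h =
    ((cnorm h + 1)%:C%:A - (e%:C%:A + h)) + e%:C%:A by rewrite opprD addrA addrAC subrK.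
apply: le_trans (cnormD_le _ _) _; rewrite cnorm_alg gtr0_norm // lerD2r.
apply: cnorm_npos_sub; first exact: he.
by apply: le_trans (cnormD_le _ _) _; rewrite cnorm_alg gtr0_norm //; lra.
Qed.

(** In [g - e = g * (1 - e * g^-1)] the second factor is [npos] once [e * cnorm g^-1 <= 1]. *)
Lemma npos_unit_lower g r : npos g -> g \is a GRing.unit -> 0 < r ->
  exists e, 0 < e <= r /\ npos (g - e%:C%:A).
Proof.
move=> ng ug r0; have [sg _] := ng; have n0 := cnorm_ge0 g^-1.
have dp : 0 < 1 + r * cnorm g^-1 by rewrite ltr_pwDl // mulr_ge0 // ltW.
(* This value is at most both [r] and, when [cnorm g^-1] is nonzero, its inverse. *)
exists (r / (1 + r * cnorm g^-1)); set e := r / _.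
have e0 : 0 < e by rewrite divr_gt0.
have eE : e * (1 + r * cnorm g^-1) = r by rewrite divfK // gt_eqF.
have h0 : 0 <= e * (r * cnorm g^-1).
  by apply: (mulr_ge0 (ltW e0) (mulr_ge0 (ltW r0) n0)).
split; first by apply/andP; split; lra.
have -> : g - e%:C%:A = g * (1%:C%:A - e%:C *: g^-1).
  by rewrite rmorph1 scale1r mulrBr mulr1 -scalerAr mulrV.
apply: npos_mul_comm => //; last first.
  apply: commrB; first exact/commr_sym/comm_alg.
  by apply/comm_rscale/commrV.
apply: npos_sub; first by rewrite starZr starV // sg.
rewrite cnormZr gtr0_norm //; rewrite -(ler_pM2r r0) mul1r; lra.
Qed.

(** The norm [N] of [q] is a spectral value: were [N - q] invertible with [N > 0], it would dominate
    some [e > 0], forcing [N <= N - e]. *)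
Lemma npos_resolvent_eq0 q : npos q ->
  (forall r, 0 < r -> 1 - r%:C *: q \is a GRing.unit) -> q = 0.
Proof.
move=> nq uq; have [sq _] := nq; apply: cnorm_eq0; apply/eqP/negP => /negP q0.
set N := cnorm q in q0; have N0 : 0 < N by rewrite lt_def q0 cnorm_ge0.
pose g : A := N%:C%:A - q.
have ng : npos g by apply: npos_sub.
have ug : g \is a GRing.unit.
  have -> : g = N%:C *: (1 - N^-1%:C *: q) by rewrite scalerBr rscaleK.
  by rewrite scaler_unit ?uq ?invr_gt0 // unitfE fmorph_eq0.
have [e [/andP[e0 eN] /npos_sqrt[m [[sm _] m2 mC]]]] := npos_unit_lower ng ug N0.
have [k [[sk _] k2 kC]] := npos_sqrt nq.
have NE : cnorm k ^+ 2 = N by rewrite -cnorm_sqr // k2.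
have : cnorm k ^+ 2 <= `|N - e|.
  apply: (@cnorm_sum_sqr _ m) => //.
    apply/mC/commrB; last exact/commr_sym/comm_alg.
    apply: commrB; first exact/commr_sym/comm_alg.
    by apply/commr_sym/kC.
  by rewrite k2 m2 addrC addrAC subrK rmorphB scalerBl.
rewrite NE ger0_norm; lra.
Qed.

End NormPositive.

(** * Positivity of [star t * t] and the parallel sum *)

Lemma unit_one_add_mulC (S : unitRingType) (x y : S) :
  1 + x * y \is a GRing.unit -> 1 + y * x \is a GRing.unit.
Proof.
have xyx : x * (1 + y * x) = (1 + x * y) * x.
  by rewrite mulrDr mulrDl mulr1 mul1r mulrA.
have yxy : (1 + y * x) * y = y * (1 + x * y).
  by rewrite mulrDr mulrDl mulr1 mul1r mulrA.
move=> u; apply/unitrP; exists (1 - y * (1 + x * y)^-1 * x); split.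
  by rewrite mulrBl mul1r -!mulrA xyx mulKr // addrK.
by rewrite mulrBr mulr1 !mulrA yxy mulrK // addrK.
Qed.

Section Positive.
Context {R : realType} {A : cstarAlgType R}.
Implicit Types (a b g h t x y z : A) (e r : R).

(** Here [a] plays the role of |h|. With the invertible [b = e + a], the quotient [u = h / b] is a
    contraction because [1 - u^2 = (b^2 - h^2) / b^2] is [npos]; then [e + a + h = b * (1 + u)], and
    [e] tends to 0. *)
Lemma npos_abs_add a h : npos a -> star h = h -> GRing.comm a h ->
  a ^+ 2 = h ^+ 2 -> npos (a + h).
Proof.
move=> na sh ah a2h2; have [sa _] := na.
apply: npos_closed => [|e e0]; first by rewrite starD sa sh.
pose b : A := e%:C%:A + a.
have nb : npos b by apply: nposD => //; apply/npos_alg/ltW.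
have [sb _] := nb; have ub : b \is a GRing.unit by apply: npos_unit.
have hb : GRing.comm h b.
  by apply: commrD; [exact/commr_sym/comm_alg | exact: commr_sym].
have sV : star b^-1 = b^-1 by rewrite starV // sb.
have hV := commrV hb; pose u := h * b^-1.
have su : star u = u by rewrite starM sV sh.
have bu : GRing.comm u b by apply/commr_sym/commrM; [exact: commr_sym | exact: commrV].
have nd : npos (b ^+ 2 - h ^+ 2).
  have -> : b ^+ 2 - h ^+ 2 = e%:C *: (b + a).
    rewrite -a2h2 !expr2 {1}/b mulrDl mulr_algl {2}/b mulrDr mulr_algr.
    by rewrite addrA addrK -scalerDr.
  apply: nposZ; first exact: ltW.
  exact: nposD.
have : npos (1 - u ^+ 2).
  have -> : 1 - u ^+ 2 = (b ^+ 2 - h ^+ 2) * b^-1 ^+ 2.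
    by rewrite mulrBl -!exprMn_comm // ?mulrV ?expr1n //; apply: commrV.
  apply: npos_mul_comm => //; first exact: npos_sqr.
  by apply/commrX/commrV/commr_sym/commrB; apply: commrX; [exact: commr_refl | exact: commr_sym].
move=> /npos_sqrt[m [[sm _] m2 mC]].
have u1 : cnorm u <= 1.
  rewrite -(@expr_le1 _ 2) ?cnorm_ge0 // -[leRHS]normr1.
  apply: (cnorm_sum_sqr su sm); last by rewrite m2 addrC subrK rmorph1 scale1r.
  by apply: mC; apply: commrB; [exact: commr1 | exact: commrX].
have -> : e%:C%:A + (a + h) = b * (1 + u).
  by rewrite mulrDr mulr1 /u hV mulVKr // addrA.
apply: npos_mul_comm => //; last first.
  by apply: commrD; [exact: commr1 | exact: commr_sym].
have := @npos_sub _ _ 1 (- u); rewrite starN su cnormN opprK rmorph1 scale1r.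
exact.
Qed.

(* [star z * z] and [z * star z] have the same nonzero spectrum, and their sum
   is a sum of squares of self-adjoint elements. *)
Lemma npos_opp_star_mul z : npos (- (star z * z)) -> z = 0.
Proof.
move=> nq.
suff q0 : - (star z * z) = 0.
  apply: cnorm_eq0; apply/eqP; rewrite -sqrf_eq0 -cnorm_starM.
  by move/eqP: q0; rewrite oppr_eq0 => /eqP ->; rewrite cnorm0.
apply: npos_resolvent_eq0 => // r r0.
(* Up to sign, these are twice the real and imaginary parts of [z]. *)
pose x := z + star z; pose y := 'i%C *: (z - star z).
have sx : star x = x by rewrite starD starK addrC.
have sy : star y = y.
  have iC : conjc 'i%C = - 'i%C :> R[i].
    by apply/eqP; rewrite eq_complex /= oppr0 !eqxx.
  by rewrite starZ starB starK iC scaleNr -scalerN opprB.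
have xy : x ^+ 2 + y ^+ 2 = 2%:C *: (z * star z + star z * z).
  have xw : x - (z - star z) = 2%:C *: star z.
    by rewrite rmorph_nat scaler_nat opprB addrC addrA subrK mulr2n.
  have xw' : x + (z - star z) = 2%:C *: z.
    by rewrite rmorph_nat scaler_nat addrACA subrr addr0 mulr2n.
  rewrite exprZn sqr_i scaleN1r !expr2 {2}/x mulrDr [in X in - X]mulrBr opprB.
  rewrite [(_ - _) * _ - _]addrC addrACA -mulrBl -mulrDl xw xw' -!scalerAl.
  by rewrite -scalerDr addrC.
have nzz : npos (z * star z).
  have -> : z * star z = 2^-1%:C *: (x ^+ 2 + y ^+ 2) + - (star z * z).
    rewrite xy scalerA -rmorphM mulVf ?pnatr_eq0 // rmorph1 scale1r.
    by rewrite addrK.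
  by apply: nposD => //; apply: nposZ; rewrite ?invr_ge0 //; apply: nposD; apply: npos_sqr.
rewrite scalerN opprK scalerAr; apply: unit_one_add_mulC.
rewrite -scalerAl -[X in X + _]scale1r -[X in X *: _](rmorph1 (real_complex R)).
by apply: npos_unit => //; apply: nposZ => //; apply: ltW.
Qed.

Lemma npos_star_mul t : npos (star t * t).
Proof.
pose h := star t * t; have sh : star h = h by rewrite starM starK.
have [a [na a2 aC]] := npos_sqrt (npos_sqr sh); have [sa _] := na.
have ah : GRing.comm a h by apply/commr_sym/aC/commrX/commr_refl.
pose n := a - h.
have nn : npos n by apply: npos_abs_add; rewrite ?starN ?sh ?sqrrN //; apply: commrN.
have sn : star n = n by case: nn.
have an : GRing.comm a n by apply: commrB.
have hn : h * n = - (a * n).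
  by rewrite /n mulrBr mulrBr -!expr2 a2 opprB ah.
have tn0 : t * n = 0.
  apply: npos_opp_star_mul.
  have -> : - (star (t * n) * (t * n)) = a * n ^+ 2.
    by rewrite starM sn -mulrA (mulrA _ t) -/h hn mulrN opprK mulrA -an expr2 mulrA.
  by apply: npos_mul_comm => //; [exact: npos_sqr | exact: commrX].
have hn0 : h * n = 0 by rewrite -mulrA tn0 mulr0.
(* From [h * n = 0] and [h * n = - (a * n)] also [a * n = 0], whence [n^2 = (a - h) * n = 0]. *)
have n0 : n = 0.
  apply: sa_sqr_eq0 => //; rewrite expr2 {1}/n mulrBl hn0 subr0.
  by apply: oppr_inj; rewrite -hn oppr0.
by move/eqP: n0; rewrite subr_eq0 -/h => /eqP <-.
Qed.

Lemma cstar_positive_npos a : cstar_positive a <-> npos a.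
Proof.
split=> [[t ->]|/npos_sqrt[k [[sk _] <- _]]]; first exact: npos_star_mul.
by exists k; rewrite sk expr2.
Qed.

(** An invertible [g] stays above some scalar [e > 0], and so does [g + h]. *)
Lemma npos_unitD g h : npos g -> g \is a GRing.unit -> npos h ->
  g + h \is a GRing.unit.
Proof.
move=> ng ug nh; have [e [/andP[e0 _] nge]] := npos_unit_lower ng ug ltr01.
have -> : g + h = e%:C%:A + ((g - e%:C%:A) + h) by rewrite addrA (addrC _ (g - _)) subrK.
by apply: npos_unit => //; apply: nposD.
Qed.

Lemma unit_addV g h : g \is a GRing.unit -> h \is a GRing.unit ->
  g + h \is a GRing.unit -> g^-1 + h^-1 \is a GRing.unit.
Proof.
move=> ug uh ugh; have -> : g^-1 + h^-1 = g^-1 * (g + h) * h^-1.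
  by rewrite mulrDr mulVr // mulrDl mul1r mulrK // addrC.
by rewrite !unitrMl ?unitrV.
Qed.

(* The deviation from the minimiser [(g^-1 * p, h^-1 * p)] of
   [star x * g * x + star y * h * y] on [x + y = 1] enters as a square. *)
Lemma parallel_sum_defect g h x y (p := (g^-1 + h^-1)^-1) (d := x - g^-1 * p) :
    star g = g -> star h = h -> g \is a GRing.unit -> h \is a GRing.unit ->
    g^-1 + h^-1 \is a GRing.unit -> x + y = 1 ->
  star x * g * x + star y * h * y = p + star d * (g + h) * d.
Proof.
move=> sg sh ug uh us xy.
have sV k : star k = k -> k \is a GRing.unit -> star k^-1 = k^-1.
  by move=> sk uk; rewrite starV // sk.
have sp : star p = p by rewrite sV // starD !sV.
have sum1 : g^-1 * p + h^-1 * p = 1 by rewrite -mulrDl mulrV.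
(* The cross terms do not involve [k], so they cancel between [c = d] for [g] and [c = - d] for
   [h]. *)
have expand k c : star k = k -> k \is a GRing.unit ->
    star (k^-1 * p + c) * k * (k^-1 * p + c)
    = p * k^-1 * p + (p * c + star c * p) + star c * k * c.
  move=> sk uk; rewrite starD starM sp sV // [_ * k]mulrDl mulrVK //.
  rewrite mulrDr !mulrDl !mulrA mulrK //.
  by rewrite -!addrA; congr (_ + _); exact: addrCA.
have xE : x = g^-1 * p + d by rewrite addrC subrK.
have yE : y = h^-1 * p + - d.
  by rewrite opprB addrA (addrC (h^-1 * p)) sum1 -xy (addrC x) addrK.
rewrite yE {1 2}xE !expand // starN !mulrN !mulNr opprK.
rewrite addrACA (addrACA (p * g^-1 * p)) -opprD subrr addr0 -mulrDl -mulrDr.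
by rewrite mulVr // mul1r -mulrDl -mulrDr.
Qed.

End Positive.

(** * The contraharmonic mean as a maximum *)

Theorem theorem2p5 (R : realType) (A : cstarAlgType R) (nu : R) (a b : A)
    (nu_gt0 : 0 < nu) (nu_lt1 : nu < 1)
    (a_posdef : cstar_posdef a) (b_posdef : cstar_posdef b) :
  cstar_greatest
    [set z : A | exists x y : A, x + y = 1 /\
       z = ((1 - nu)^-1)%:C *: (nu%:C *: a - star x * a * x)
           + (nu^-1)%:C *: ((1 - nu)%:C *: b - star y * b * y)]
    (contraharmonic nu a b).
Proof.
have nu0 : nu != 0 by rewrite gt_eqF.
have mu_gt0 : 0 < 1 - nu by rewrite subr_gt0.
have mu0 : 1 - nu != 0 by rewrite gt_eqF.
have [/cstar_positive_npos na ua] := a_posdef.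
have [/cstar_positive_npos nb ub] := b_posdef.
have unitC (r : R) : r != 0 -> r%:C \is a GRing.unit by rewrite unitfE fmorph_eq0.
pose g : A := (1 - nu)^-1%:C *: a; pose h : A := nu^-1%:C *: b.
have ng : npos g by apply: nposZ => //; rewrite invr_ge0 ltW.
have nh : npos h by apply: nposZ => //; rewrite invr_ge0 ltW.
have ug : g \is a GRing.unit by rewrite scaler_unit ?unitC ?invr_eq0.
have uh : h \is a GRing.unit by rewrite scaler_unit ?unitC ?invr_eq0.
have [sg _] := ng; have [sh _] := nh; have [sa _] := na; have [sb _] := nb.
have gV : g^-1 = (1 - nu)%:C *: a^-1.
  by rewrite invrZ ?unitC ?invr_eq0 // -fmorphV invrK.
have hV : h^-1 = nu%:C *: b^-1 by rewrite invrZ ?unitC ?invr_eq0 // -fmorphV invrK.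
have ugh : g + h \is a GRing.unit by apply: npos_unitD.
have us : g^-1 + h^-1 \is a GRing.unit by apply: unit_addV.
pose p := (g^-1 + h^-1)^-1; pose C := contraharmonic nu a b.
have CE : C = nu%:C *: g + (1 - nu)%:C *: h - p.
  by rewrite /C /contraharmonic /p gV hV !scalerA -!rmorphM [_ *: b + _]addrC.
have sC : star C = C.
  by rewrite CE starB starD (starZr nu) (starZr (1 - nu)) sg sh starV // starD !starV // sg sh.
(* The gap between [C] and a competitor is exactly the defect term of the parallel sum. *)
have key (x y : A) : x + y = 1 ->
    (1 - nu)^-1%:C *: (nu%:C *: a - star x * a * x)
      + nu^-1%:C *: ((1 - nu)%:C *: b - star y * b * y)
    = C - star (x - g^-1 * p) * (g + h) * (x - g^-1 * p).
  move=> xy; have := parallel_sum_defect sg sh ug uh us xy; rewrite -/p => defect.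
  rewrite CE -addrA -opprD -defect opprD addrACA /g /h.
  rewrite -!scalerAr -!scalerAl !scalerBr !scalerA.
  by rewrite [_%:C * nu%:C]mulrC [_%:C * (1 - nu)%:C]mulrC.
split.
  (* At this pair the deviation vanishes, so the value is [C] itself. *)
  exists (g^-1 * p), (h^-1 * p); have xy : g^-1 * p + h^-1 * p = 1.
    by rewrite -mulrDl mulrV.
  by split=> //; rewrite key // subrr star0 !mul0r subr0.
move=> _ [x [y [xy ->]]]; rewrite key //.
(* Writing [g + h] as [star w * w] turns the gap into [star (w * d) * (w * d)]. *)
move: (x - g^-1 * p) => d; have /cstar_positive_npos[w wE] := nposD ng nh.
have -> : star d * (g + h) * d = star (w * d) * (w * d).
  by rewrite wE starM !mulrA.
split; [|exact: sC|].
- by rewrite /selfadjoint (starB C) sC starM starK.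
- by exists (w * d); rewrite -/C opprB addrC subrK.
Qed.
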